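(* Let $N>M\ge1$ be integers and let $c_{w,k}$ be the passive multiplicity of shell $k$ in the target Hamming-weight-$w$ sector (defined in the context). A shell-by-shell Hamming-symmetric optimal permutation exists if and only if $$c_{w,k}\equiv0\pmod{\tbinom Mw}\qquad\text{for every } w=0,\dots,M\text{ and }k=0,\dots,N.$$
   Context: Setting: $N$ qubits, computational basis indexed by $\{0,1\}^N$; the first $M$ bits are the target bits and the remaining $N-M$ bits the ancillary bits. ''Shell $k$'' is the set of the $\binom Nk$ strings with $k$ ones; in the thermal state $\rho(P_1)=(P_0|0\rangle\langle0|+P_1|1\rangle\langle1|)^{\otimes N}$, $P_0=1-P_1$, $0<P_1<1/2$, these have eigenvalue $q_k=P_0^{N-k}P_1^k$, strictly decreasing in $k$. The target-weight-$w$ sector is the set of strings whose first $M$ bits have Hamming weight $w$. Passive multiplicities: with $B_k=\sum_{j=0}^k\binom Nj$, $B_{-1}=0$, and $G_w=2^{N-M}\sum_{r=0}^w\binom Mr$, $G_{-1}=0$, set $$c_{w,k}=\max\{0,\ \min(B_k,G_w)-\max(B_{k-1},G_{w-1})\},$$ the number of shell-$k$ eigenvalues placed in sector $w$ when the eigenvalues, in decreasing order, fill the sectors in order of increasing $w$. An optimal permutation is a permutation $\pi$ of $\{0,1\}^N$ that sends exactly $c_{w,k}$ strings of shell $k$ into target sector $w$, for all $w,k$ (equivalently, the corresponding unitary minimizes the total target excitation $\operatorname{Tr}(\sum_{\alpha\le M}|1\rangle\langle1|_\alpha U\rho(P_1)U^\dagger)$ over all unitaries $U$). For $x\in\{0,1\}^M$,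 let $n_{x,k}$ be the number of shell-$k$ strings that $\pi$ sends to strings whose first $M$ bits equal $x$. The permutation is shell-by-shell Hamming symmetric if $n_{x,k}=n_{y,k}$ for all $k$ whenever $x,y\in\{0,1\}^M$ have the same Hamming weight. *)

(* Defs.v *)
From mathcomp Require Import all_boot all_fingroup.
Set Implicit Arguments.
Unset Strict Implicit.
Unset Printing Implicit Defensive.

(* Hamming weight of a bit string; [true] is the excited state 1.  Shell [k] of
   {0,1}^N is the set of [s : N.-tuple bool] with [weight s = k]. *)
Definition weight (s : seq bool) : nat := count id s.

(* [cumB N k] is B_(k-1) and [cumG N M w] is G_(w-1): the indices are shifted
   by one so that the conventions B_(-1) = G_(-1) = 0 are the empty sums. *)
Definition cumB (N k : nat) : nat := \sum_(j < k) 'C(N, j).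

Definition cumG (N M w : nat) : nat := 2 ^ (N - M) * \sum_(r < w) 'C(M, r).

(* The outer max{0, _} is the truncation of the subtraction on [nat]. *)
Definition passive_mult (N M w k : nat) : nat :=
  minn (cumB N k.+1) (cumG N M w.+1) - maxn (cumB N k) (cumG N M w).

(* The target bits are the first [M] bits; the other [N - M] are ancillary. *)
Definition target (M : nat) (s : seq bool) : seq bool := take M s.

Definition optimal (N M : nat) (p : {perm N.-tuple bool}) : Prop :=
  forall w k : nat, w <= M -> k <= N ->
    #|[set s : N.-tuple bool
        | (weight s == k) && (weight (target M (p s)) == w)]|
    = passive_mult N M w k.

Definition fiber_count (N M : nat) (p : {perm N.-tuple bool})
    (x : M.-tuple bool) (k : nat) : nat :=
  #|[set s : N.-tuple bool
      | (weight s == k) && (target M (p s) == x :> seq bool)]|.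

Definition Hamming_symmetric (N M : nat) (p : {perm N.-tuple bool}) : Prop :=
  forall x y : M.-tuple bool, weight x = weight y ->
    forall k : nat, k <= N -> fiber_count p x k = fiber_count p y k.

(* Main.v *)
Require Import Defs.
From mathcomp Require Import all_boot all_fingroup zify.

(** Divisibility is necessary because the sector of weight [w] consists of
    ['C(M, w)] fibers contributing equally to [c_(w,k)].  Conversely, setting
    [n_(x,k) := c_(w,k) / 'C(M, w)] for [x] of weight [w] gives a nonnegative
    integer matrix; as the [c_(w,k)] are the overlaps of two subdivisions of
    [[0, 2^N)], it has row sums [2^(N-M)] and column sums ['C(N, k)], which are
    the sizes of the fibers and of the shells.  Any such matrix is realized by a
    permutation: list the pairs (shell, fiber) with multiplicity [n_(x,k)], and
    enumerate the strings once along the first components and once along the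
    second. *)

(** * Permutations with prescribed joint label counts *)

Lemma count_enum {T : finType} (P : pred T) : count P (enum T) = #|[set x | P x]|.
Proof. by rewrite cardsE cardE size_filter enumT. Qed.

(** A rearrangement of labels is a permutation of positions, and the same permutation of positions
    applied to [enum T] carries the elements along. *)
Lemma reorder_map_eq {T : finType} {K : eqType} (t0 : T) (a : T -> K)
    (u : seq K) :
  perm_eq u (map a (enum T)) ->
  exists2 s : seq T, perm_eq s (enum T) & map a s = u.
Proof.
move=> /(perm_iotaP (a t0)) [I permI ->].
rewrite size_map in permI.
exists (map (nth t0 (enum T)) I).
  by apply/(perm_iotaP t0); exists I.
rewrite -map_comp; apply/eq_in_map => i.
by rewrite (perm_mem permI) mem_iota add0n => /andP[_ ltiT] /=; rewrite (nth_map t0).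
Qed.

(** Matching equal positions of two duplicate-free enumerations of [T] is a bijection; [t0] is only
    the default of [nth]. *)
Lemma perm_between_enumerations {T : finType} (t0 : T) (s1 s2 : seq T) :
  perm_eq s1 (enum T) -> perm_eq s2 (enum T) ->
  exists p : {perm T}, map p s1 = s2.
Proof.
move=> perm1 perm2.
have uniq1 : uniq s1 by rewrite (perm_uniq perm1) enum_uniq.
have uniq2 : uniq s2 by rewrite (perm_uniq perm2) enum_uniq.
have mem1 x : x \in s1 by rewrite (perm_mem perm1) mem_enum.
have size12 : size s1 = size s2 by rewrite (perm_size perm1) (perm_size perm2).
pose f x := nth t0 s2 (index x s1).
have f_inj : injective f.
  move=> x y /eqP; rewrite nth_uniq -?size12 ?index_mem // => /eqP eqxy.
  by rewrite -(nth_index t0 (mem1 x)) eqxy nth_index.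
exists (perm f_inj); apply: (@eq_from_nth _ t0); rewrite size_map // => i lti.
by rewrite (nth_map t0) // permE /f index_uniq.
Qed.

Lemma exists_perm_count_labels {T : finType} {K X : eqType} (t0 : T)
    (a : T -> K) (b : T -> X) (L : seq (K * X)) :
  perm_eq (map fst L) (map a (enum T)) ->
  perm_eq (map snd L) (map b (enum T)) ->
  exists p : {perm T}, forall P : pred (K * X),
    #|[set s | P (a s, b (p s))]| = count P L.
Proof.
move=> /(reorder_map_eq t0)[s1 perm1 map1] /(reorder_map_eq t0)[s2 perm2 map2].
have [p map_p] := perm_between_enumerations t0 _ _ perm1 perm2.
exists p => P.
(* [s1] lifts the first components of [L] and [p] carries it to [s2], which lifts the second ones,
   so zipping recovers [L]. *)
have -> : L = [seq (a s, b (p s)) | s <- s1].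
  rewrite -(zip_unzip L) /unzip1 /unzip2 -map1 -map2 -map_p -map_comp.
  by rewrite zip_map.
by rewrite count_map (seq.permP perm1) count_enum.
Qed.

Lemma count_flatten_nseq {U : finType} (n : U -> nat) (P : pred U) :
  count P (flatten [seq nseq (n u) u | u <- enum U]) = \sum_(u | P u) n u.
Proof.
rewrite count_flatten -map_comp sumnE big_map enumT [RHS]big_mkcond.
by apply: eq_bigr => u _; rewrite /= count_nseq; case: (P u); rewrite ?mul1n.
Qed.

Lemma exists_perm_of_marginals {T K X : finType} (t0 : T)
    (a : T -> K) (b : T -> X) (n : K -> X -> nat) :
  (forall k, \sum_x n k x = #|[set s | a s == k]|) ->
  (forall x, \sum_k n k x = #|[set s | b s == x]|) ->
  exists p : {perm T}, forall P : K -> X -> bool,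
    #|[set s | P (a s) (b (p s))]| = \sum_k \sum_(x | P k x) n k x.
Proof.
move=> sum_a sum_b.
pose L := flatten [seq nseq (n u.1 u.2) u | u <- enum {: K * X}].
have countL P : count P L = \sum_k \sum_(x | P (k, x)) n k x.
  rewrite count_flatten_nseq [RHS]pair_big_dep /=.
  by apply: eq_big => [[k x]|[k x] _].
have label_count (Y : finType) (c : T -> Y) y :
    count_mem y (map c (enum T)) = #|[set s | c s == y]|.
  by rewrite count_map count_enum.
(* [perm_eq] unfolds to equal multiplicities of each label, which is the hypothesis on the
   marginals. *)
have permK : perm_eq (map fst L) (map a (enum T)).
  apply/allP => k _ /=; rewrite label_count -sum_a count_map countL.
  rewrite (bigD1 k) //= eqxx [X in _ + X]big1 ?addn0 // => k' /negPf nek.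
  by rewrite big_pred0 // => x; rewrite /= nek.
have permX : perm_eq (map snd L) (map b (enum T)).
  apply/allP => x _ /=; rewrite label_count -sum_b count_map countL.
  by apply/eqP/eq_bigr => k _; rewrite /= big_pred1_eq.
have [p countp] := exists_perm_count_labels t0 a b L permK permX.
exists p => P.
by rewrite (countp (fun u => P u.1 u.2)) countL.
Qed.

(** * Row and column sums of the passive multiplicities *)

(* Each overlap is an increment of [g] clamped to [[a, b]], so the sum
   telescopes. *)
Lemma sum_interval_overlaps (g : nat -> nat) (a b n : nat) :
  {homo g : i j / i <= j} -> a <= b -> g 0 <= a -> b <= g n ->
  \sum_(w < n) (minn b (g w.+1) - maxn a (g w)) = b - a.
Proof.
move=> g_homo leab le0a lebn; pose h w := maxn a (minn b (g w)).
have h_homo : {homo h : i j / i <= j}.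
  by move=> i j /g_homo; rewrite /h; lia.
rewrite (eq_bigr (fun w : 'I_n => h w.+1 - h w)) => [|w _].
  rewrite -(big_mkord xpredT (fun w => h w.+1 - h w)) telescope_sumn //.
  by rewrite /h; lia.
by have := g_homo _ _ (leqnSn w); rewrite /h; lia.
Qed.

Lemma sum_ord_homo (F : nat -> nat) :
  {homo (fun n => \sum_(j < n) F j) : i j / i <= j}.
Proof.
by apply: homo_leq => [//|? ? ?|n]; [exact: leq_trans|rewrite big_ord_recr leq_addr].
Qed.

Lemma sum_binomial (n : nat) : \sum_(j < n.+1) 'C(n, j) = 2 ^ n.
Proof.
rewrite -[2]/(1 + 1) expnDn; apply: eq_bigr => i _.
by rewrite !exp1n !muln1.
Qed.

Lemma cumB_homo (N : nat) : {homo cumB N : i j / i <= j}.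
Proof. exact: sum_ord_homo. Qed.

Lemma cumG_homo (N M : nat) : {homo cumG N M : i j / i <= j}.
Proof. by move=> i j leij; rewrite leq_mul2l sum_ord_homo ?orbT. Qed.

Lemma cumB_full (N : nat) : cumB N N.+1 = 2 ^ N.
Proof. exact: sum_binomial. Qed.

Lemma cumG_full (N M : nat) : M <= N -> cumG N M M.+1 = 2 ^ N.
Proof. by move=> leMN; rewrite /cumG sum_binomial -expnD subnK. Qed.

Lemma sum_passive_mult_sectors (N M k : nat) :
  M <= N -> k <= N -> \sum_(w < M.+1) passive_mult N M w k = 'C(N, k).
Proof.
move=> leMN lekN; rewrite sum_interval_overlaps ?cumB_homo //.
- by rewrite /cumB big_ord_recr addKn.
- exact: cumG_homo.
- by rewrite /cumG big_ord0 muln0.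
- by rewrite cumG_full // -cumB_full cumB_homo.
Qed.

Lemma sum_passive_mult_shells (N M w : nat) :
  M <= N -> w <= M ->
  \sum_(k < N.+1) passive_mult N M w k = 2 ^ (N - M) * 'C(M, w).
Proof.
move=> leMN lewM.
(* An overlap is symmetric in its two intervals, so the shells can now play the part of the
   subdivision. *)
under eq_bigr => k _ do rewrite /passive_mult minnC maxnC.
rewrite sum_interval_overlaps ?cumG_homo //.
- by rewrite /cumG big_ord_recr mulnDr addKn.
- exact: cumB_homo.
- by rewrite /cumB big_ord0.
- by rewrite cumB_full -(cumG_full _ _ leMN) cumG_homo.
Qed.

(** * Sizes of shells and fibers *)

Lemma weight_le {n : nat} (s : n.-tuple bool) : weight s <= n.
Proof. by rewrite -[leqRHS](size_tuple s) count_size. Qed.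

(** A bit string is the indicator of its support, so shell [k] corresponds to the [k]-subsets of
    ['I_n]. *)
Lemma card_weight (n k : nat) :
  #|[set s : n.-tuple bool | weight s == k]| = 'C(n, k).
Proof.
pose f (s : n.-tuple bool) : {set 'I_n} := [set i | tnth s i].
have f_bij : bijective f.
  exists (fun A : {set 'I_n} => [tuple i \in A | i < n]) => [s|A].
    by apply: eq_from_tnth => i; rewrite tnth_mktuple inE.
  by apply/setP => i; rewrite inE tnth_mktuple.
rewrite -[n in RHS]card_ord -card_draws -(on_card_preimset (f := f)); last first.
  by case: f_bij => g fK gK; exists g => x _.
apply: eq_card => s; rewrite !inE; congr (_ == k).
by rewrite /weight -sum1_count big_tuple cardsE sum1_card.
Qed.

(** The fiber labels must form a [finType], whereas [target] returns a bare sequence. Reading bits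
    with a default gives length [M] without a proof of [M <= N]. *)
Definition target_tuple {N : nat} (M : nat) (s : N.-tuple bool) : M.-tuple bool :=
  [tuple nth false s i | i < M].

Lemma val_target_tuple {N M : nat} (s : N.-tuple bool) :
  M <= N -> target_tuple M s = target M s :> seq bool.
Proof.
move=> leMN; have sizeM : size (target M s) = M by rewrite size_takel ?size_tuple.
apply: (@eq_from_nth _ false); rewrite size_tuple ?sizeM // => i ltiM.
by rewrite -(tnth_nth false _ (Ordinal ltiM)) tnth_mktuple nth_take.
Qed.

(** The fiber is the injective image of the free ancillary strings [y] under [x ++ y]. *)
Lemma card_target_fiber {N M : nat} (x : M.-tuple bool) :
  M <= N -> #|[set s : N.-tuple bool | target_tuple M s == x]| = 2 ^ (N - M).
Proof.
move=> leMN.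
have sizeN (y : (N - M).-tuple bool) : size (x ++ y) == N.
  by rewrite size_cat !size_tuple subnKC.
pose f y : N.-tuple bool := Tuple (sizeN y).
have f_inj : injective f.
  by move=> y z /(congr1 val) /eqP; rewrite eqseq_cat // eqxx => /eqP /val_inj.
rewrite -[2]card_bool -card_tuple -cardsT -(card_imset _ f_inj).
apply: eq_card => s; rewrite inE -val_eqE /= val_target_tuple //.
apply/eqP/imsetP => [takex|[y _ ->]]; last first.
  by rewrite /target /= take_size_cat // size_tuple.
have size_drop : size (drop M s) == N - M by rewrite size_drop size_tuple.
exists (Tuple size_drop) => //.
by apply/val_inj; rewrite /= -takex cat_take_drop.
Qed.

Lemma sum_over_weight {n : nat} (F : nat -> nat) (w : nat) :
  \sum_(x : n.-tuple bool | weight x == w) F (weight x) = 'C(n, w) * F w.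
Proof.
rewrite (eq_bigr (fun=> F w)) => [|x /eqP -> //].
by rewrite sum_nat_const -card_weight cardsE.
Qed.

Lemma sum_by_weight {n : nat} (F : nat -> nat) :
  \sum_(x : n.-tuple bool) F (weight x) = \sum_(w < n.+1) 'C(n, w) * F w.
Proof.
rewrite (partition_big (fun x : n.-tuple bool => inord (weight x) : 'I_n.+1) xpredT) //.
apply: eq_bigr => w _; rewrite -sum_over_weight.
by apply: eq_bigl => x; rewrite -val_eqE /= inordK // ltnS weight_le.
Qed.

(** * Divisibility and symmetric optimal permutations *)

Lemma sector_count_fibers {N M : nat} (p : {perm N.-tuple bool}) (w k : nat) :
  M <= N ->
  #|[set s : N.-tuple bool | (weight s == k) && (weight (target M (p s)) == w)]|
  = \sum_(x : M.-tuple bool | weight x == w) fiber_count p x k.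
Proof.
move=> leMN; rewrite -sum1_card.
rewrite (partition_big (fun s => target_tuple M (p s)) (fun x => weight x == w)); last first.
  by move=> s; rewrite inE val_target_tuple // => /andP[].
apply: eq_bigr => x /eqP wx; rewrite sum1_card /fiber_count cardsE.
apply: eq_card => s; rewrite [LHS]unfold_in [RHS]unfold_in inE -val_eqE /=.
rewrite val_target_tuple //; case: (weight s == k) => //=.
by case: (target M (p s) =P x) => [->|_]; rewrite ?andbF ?wx ?eqxx.
Qed.

Lemma symmetric_optimal_dvd (N M : nat) (p : {perm N.-tuple bool}) (w k : nat) :
  M <= N -> w <= M -> k <= N -> optimal M p -> Hamming_symmetric M p ->
  'C(M, w) %| passive_mult N M w k.
Proof.
move=> leMN lewM lekN opt sym; rewrite -opt // sector_count_fibers //.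
(* As [w <= M], the sector has a fiber [x0]; by symmetry it represents all the others. *)
have /card_gt0P[x0] : 0 < #|[set x : M.-tuple bool | weight x == w]|.
  by rewrite card_weight bin_gt0.
rewrite inE => /eqP wx0.
rewrite (eq_bigr (fun=> fiber_count p x0 k)) => [|x /eqP wx].
  by rewrite sum_nat_const -cardsE card_weight dvdn_mulr.
by apply: sym; rewrite ?wx.
Qed.

Lemma exists_symmetric_optimal (N M : nat) :
  M <= N ->
  (forall w k, w <= M -> k <= N -> 'C(M, w) %| passive_mult N M w k) ->
  exists p : {perm N.-tuple bool}, optimal M p /\ Hamming_symmetric M p.
Proof.
move=> leMN dvd_c.
pose n w k := passive_mult N M w k %/ 'C(M, w).
have nE w k : w <= M -> k <= N -> 'C(M, w) * n w k = passive_mult N M w k.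
  by move=> lewM lekN; rewrite mulnC divnK ?dvd_c.
(* [inord] loses nothing here, since weights are at most [N]. *)
pose a (s : N.-tuple bool) : 'I_N.+1 := inord (weight s).
have aE s (k : 'I_N.+1) : (a s == k) = (weight s == k).
  by rewrite -val_eqE /= inordK // ltnS weight_le.
have sum_shell (k : 'I_N.+1) :
    \sum_(x : M.-tuple bool) n (weight x) k = #|[set s | a s == k]|.
  rewrite (sum_by_weight (fun w => n w k)).
  rewrite (eq_bigr (fun w : 'I_M.+1 => passive_mult N M w k)) => [|w _]; last first.
    exact: nE (ltn_ord w) (ltn_ord k).
  rewrite sum_passive_mult_sectors ?leq_ord // -card_weight.
  by apply: eq_card => s; rewrite !inE aE.
have sum_fiber (x : M.-tuple bool) :
    \sum_(k < N.+1) n (weight x) k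
    = #|[set s : N.-tuple bool | target_tuple M s == x]|.
  have lewM := weight_le x; rewrite card_target_fiber //.
  have C_gt0 : 0 < 'C(M, weight x) by rewrite bin_gt0.
  (* Multiplying by the positive binomial turns the quotients [n] back into passive
     multiplicities. *)
  apply/eqP; rewrite -(eqn_pmul2l C_gt0) big_distrr /=.
  rewrite (eq_bigr (fun k : 'I_N.+1 => passive_mult N M (weight x) k)) => [|k _].
    by rewrite sum_passive_mult_shells // mulnC.
  exact: nE lewM (ltn_ord k).
have [p countp] := exists_perm_of_marginals [tuple of nseq N false] a
  (target_tuple M) (fun k x => n (weight x) k) sum_shell sum_fiber.
have fiberE (x : M.-tuple bool) k : k <= N -> fiber_count p x k = n (weight x) k.
  rewrite -ltnS => ltk; pose k0 := Ordinal ltk.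
  (* A predicate true at a single pair reads off one entry of the matrix. *)
  have := countp (fun k' x' => (k' == k0) && (x' == x)).
  rewrite (bigD1 k0) //= eqxx big_pred1_eq big1 ?addn0 => [<-|k' /negPf nek].
    apply: eq_card => s; rewrite !inE aE -val_eqE /= val_target_tuple //.
  by rewrite big_pred0 // => y; rewrite nek.
exists p; split=> [w k lewM lekN|x y eqw k lekN]; last by rewrite !fiberE ?eqw.
rewrite sector_count_fibers //.
under eq_bigr => x _ do rewrite fiberE //.
by rewrite (sum_over_weight (fun w => n w k)) nE.
Qed.

Theorem mainTheorem7 (N M : nat) (hM : 1 <= M) (hMN : M < N) :
  (exists p : {perm N.-tuple bool}, optimal M p /\ Hamming_symmetric M p) <->
  (forall w k : nat, w <= M -> k <= N ->
     passive_mult N M w k = 0 %[mod 'C(M, w)]).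
Proof.
have leMN := ltnW hMN; split=> [[p [opt sym]] w k lewM lekN|mod0].
  by apply/eqP; rewrite mod0n; apply: symmetric_optimal_dvd opt sym.
apply: exists_symmetric_optimal => // w k lewM lekN.
by rewrite /dvdn mod0 // mod0n.
Qed.
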